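(* Let $K$ be a field with a valuation $\mathrm{val}\colon K^*\to\mathbb R$ with value group $\Gamma$, admitting a group homomorphism $\Gamma\to K^*$, $\gamma\mapsto t^\gamma$, with $\mathrm{val}(t^\gamma)=\gamma$, and let $S=K[x_1,\dots,x_n]$. For homogeneous polynomials $f=\sum c_ux^u$ and $g=\sum b_ux^u$ in $S$ set $$E(f,g):=|\{u : b_u\neq 0,\ c_u=0\}|.$$ Then, for every input consisting of nonzero homogeneous polynomials $g_1,\dots,g_s\in S$, a homogeneous polynomial $f\in S$, a weight vector $w\in\mathbb R^n$ and a monomial term order $\prec$, the normal form algorithm described in the context, run with this function $E$, terminates after finitely many steps.
   Context: Notation. $R=\{a\in K:\mathrm{val}(a)\ge 0\}\cup\{0\}$ is the valuation ring, $\mathfrak m$ its maximal ideal, $\Bbbk=R/\mathfrak m$ the residue field, and $\overline a$ denotes the image of $a\in R$ in $\Bbbk$; $\mathrm{val}(0)=\infty$. For nonzero $f=\sum c_ux^u\in S$ and $w\in\mathbb R^n$, let $W=\min\{\mathrm{val}(c_u)+w\cdot u: c_u\ne 0\}$ and $$\mathrm{in}_w(f)=\sum_{\mathrm{val}(c_u)+w\cdot u=W}\overline{t^{-\mathrm{val}(c_u)}c_u}\,x^u\in\Bbbk[x_1,\dots,x_n].$$ A term order $\prec$ is a monomial order in the usual Gröbner sense; $\mathrm{in}_\prec$ denotes the leading term ($\prec$-largest). $\mathrm{lm}(f)$ is the monomial $x^u$ occurring in $\mathrm{in}_\prec(\mathrm{in}_w(f))$, and $\mathrm{lc}(f)\in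 K$ is the coefficient of this $x^u$ in $f$. Normal form algorithm. Input: nonzero homogeneous $g_1,\dots,g_s$, homogeneous $f$, $w$, $\prec$. It uses a function $E(f,g)$ from pairs of homogeneous polynomials to nonnegative integers. (1) Initialize: $T=\{g_1,\dots,g_s\}$, $h_{10}=\dots=h_{s0}=0$, $q_0=f$, $r_0=0$, $j=0$. (2) While $q_j\neq 0$ do: (a) If there is no $g\in T$ with $\mathrm{lm}(g)$ dividing $\mathrm{lm}(q_j)$, set $r_{j+1}=r_j+\mathrm{lc}(q_j)\mathrm{lm}(q_j)$, $q_{j+1}=q_j-\mathrm{lc}(q_j)\mathrm{lm}(q_j)$, $h_{i,j+1}=h_{ij}$ for all $i$, and $T=T\cup\{q_j\}$. (b) Otherwise: (i) choose $g\in T$ with $\mathrm{lm}(g)$ dividing $\mathrm{lm}(q_j)$ and $E(q_j,g)$ minimal among all such choices. (ii) If $E(q_j,g)>0$ set $T=T\cup\{q_j\}$. (iii) Let $x^v$ be the monomial with $\mathrm{lm}(x^vg)=\mathrm{lm}(q_j)$, $c_v=\mathrm{lc}(q_j)/\mathrm{lc}(x^vg)\in K$, and $p=q_j-c_vx^vg$. (iv) If $g=g_m$ for some $1\le m\le s$, set $q_{j+1}=p$, $h_{m,j+1}=h_{mj}+c_vx^v$, $h_{i,j+1}=h_{ij}$ for $i\ne m$, $r_{j+1}=r_j$. (v) If instead $g$ was added to $T$ at a previous iteration, so $g=q_m$ for some $m<j$, set $q_{j+1}=\frac1{1-c_v}p$, $h_{i,j+1}=\frac1{1-c_v}(h_{ij}-c_vh_{im})$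 for all $i$, and $r_{j+1}=\frac1{1-c_v}(r_j-c_vr_m)$. (c) Set $j=j+1$. (3) Output $h_i=h_{ij}$ for $1\le i\le s$ and $r=r_j$. *)

(* Defs.v *)
(* MathComp: {mpoly K[n]} for K[x_1, ..., x_n], R : realType for the reals. *)
From HB Require Import structures.
From mathcomp Require Import all_boot all_order all_algebra.
From mathcomp Require Import reals.
From mathcomp Require Import mpoly.

Set Implicit Arguments.
Unset Strict Implicit.
Unset Printing Implicit Defensive.

Import Order.TTheory GRing.Theory Num.Theory.
Local Open Scope ring_scope.

(* A valuation K^* -> R, given by a function on all of K.  No axiom constrains
   the value at 0 and no definition below depends on it: where the convention
   val(0) = oo matters, 0 is treated separately. *)
Record valuation (K : fieldType) (R : realType) := Valuation {
  vfun :> K -> R;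
  valM : forall a b, a != 0 -> b != 0 -> vfun (a * b) = vfun a + vfun b;
  valD : forall a b, a != 0 -> b != 0 -> a + b != 0 ->
    Num.min (vfun a) (vfun b) <= vfun (a + b)
}.

Definition value_group (K : fieldType) (R : realType) (v : valuation K R)
    (c : R) : Prop :=
  exists2 a : K, a != 0 & v a = c.

(* t : R -> K stands for the map Gamma -> K^*, c |-> t^c; its values outside of
   the value group are irrelevant. *)
Definition is_splitting (K : fieldType) (R : realType) (v : valuation K R)
    (t : R -> K) : Prop :=
  [/\ forall c, value_group v c -> t c != 0,
      forall c d, value_group v c -> value_group v d -> t (c + d) = t c * t d
    & forall c, value_group v c -> v (t c) = c].

Section ResidueField.
Variables (K : fieldType) (R : realType) (v : valuation K R).

Lemma val1 : v 1 = 0.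
Proof.
have := valM v (oner_neq0 K) (oner_neq0 K).
by rewrite mulr1 => /eqP; rewrite -subr_eq0 opprD addNKr oppr_eq0 => /eqP.
Qed.

Lemma valN1 : v (-1) = 0.
Proof.
have N1 : -1 != 0 :> K by rewrite oppr_eq0 oner_eq0.
have := valM v N1 N1; rewrite mulrNN mulr1 val1 => /esym/eqP.
by rewrite -mulr2n mulrn_eq0 /= => /eqP.
Qed.

Lemma valN a : v (- a) = v a.
Proof.
have [->|a0] := eqVneq a 0; first by rewrite oppr0.
by rewrite -mulN1r valM ?oppr_eq0 ?oner_eq0 // valN1 add0r.
Qed.

Lemma valV a : a != 0 -> v a^-1 = - v a.
Proof.
move=> a0; have a0' : a^-1 != 0 by rewrite invr_eq0.
by have := valM v a0 a0'; rewrite divff // val1 => /esym/eqP; rewrite addrC addr_eq0 => /eqP.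
Qed.

Definition valring_pred : pred K := fun a => (a == 0) || (0 <= v a).

Lemma valring_subring_closed : subring_closed valring_pred.
Proof.
rewrite /valring_pred; split=> [|a b|a b]; rewrite -!topredE /=.
- by rewrite val1 lexx orbT.
- have [->|a0] := eqVneq a 0; first by rewrite sub0r oppr_eq0 valN.
  have [->|b0] := eqVneq b 0; first by rewrite subr0 (negbTE a0).
  rewrite /= => va vb; have [//|ab0] /= := eqVneq (a - b) 0.
  have nb0 : - b != 0 by rewrite oppr_eq0.
  by apply: (le_trans _ (valD v a0 nb0 ab0)); rewrite le_min va valN.
- have [->|a0] := eqVneq a 0; first by rewrite mul0r eqxx.
  have [->|b0] := eqVneq b 0; first by rewrite mulr0 eqxx.
  by rewrite /= => va vb; rewrite valM // addr_ge0 ?orbT.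
Qed.

HB.instance Definition _ :=
  GRing.isSubringClosed.Build K valring_pred valring_subring_closed.

Definition valring : Type := {a : K | valring_pred a}.
HB.instance Definition _ := SubChoice.on valring.
HB.instance Definition _ := [SubChoice_isSubComNzRing of valring by <:].

Definition valring_max : pred valring :=
  fun a => (val a == 0) || (0 < v (val a)).

Lemma valring_max_idealr : idealr_closed valring_max.
Proof.
rewrite /valring_max; split=> [||a x y]; rewrite -!topredE /=.
- by rewrite eqxx.
- by rewrite oner_eq0 val1 ltxx.
case: a x y => [a va] [x vx] [y vy] /=; move: va; rewrite /valring_pred.
have [->|a0] := eqVneq a 0; first by rewrite mul0r add0r.
have [->|x0] := eqVneq x 0; first by rewrite mulr0 add0r.
have ax0 : a * x != 0 by rewrite mulf_neq0.
have [->|y0] := eqVneq y 0.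
  by rewrite addr0 /= => va vx0 _; rewrite valM // ltr_wpDl ?orbT.
rewrite /= => va vx0 vy0; have [//|s0] /= := eqVneq (a * x + y) 0.
apply: (lt_le_trans _ (valD v ax0 y0 s0)).
by rewrite lt_min vy0 valM // ltr_wpDl.
Qed.

HB.instance Definition _ :=
  isIdealr.Build valring valring_max valring_max_idealr.

Definition residue_field : Type :=
  {ideal_quot (valring_max : idealr valring)}.
HB.instance Definition _ := GRing.ComNzRing.on residue_field.
HB.instance Definition _ := NzRingQuotient.on residue_field.

(* \overline a; only meaningful for a in the valuation ring (insubd sends any
   other a to 0). *)
Definition residue (a : K) : residue_field :=
  \pi_residue_field%qT (insubd (0 : valring) a).

Lemma residue_eq0 (x : valring) :
  (\pi_residue_field%qT x == 0) = valring_max x.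
Proof.
rewrite -(rmorph0 (\pi_residue_field%qT)).
by rewrite -(Quotient.idealrBE (valring_max : idealr valring)) subr0.
Qed.

Definition residue_inv (x : residue_field) : residue_field :=
  residue (val (repr x))^-1.

Lemma residue_mulVf x : x != 0 -> residue_inv x * x = 1.
Proof.
rewrite /residue_inv -{1 3}[x]reprK residue_eq0.
case: (repr x) => a va; rewrite /valring_max /= negb_or -leNgt.
move=> /andP[a0 va0]; rewrite /residue.
have vV : valring_pred a^-1 by rewrite /valring_pred valV // oppr_ge0 va0 orbT.
rewrite -rmorphM -[RHS](rmorph1 (\pi_residue_field%qT)).
by congr (\pi_residue_field%qT _); apply/val_inj; rewrite /= insubdK // mulVf.
Qed.

Lemma residue_inv0 : residue_inv 0 = 0.
Proof.
have : valring_max (repr (0 : residue_field)).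
  by rewrite -residue_eq0 reprK.
rewrite /residue_inv; case: (repr _) => a va; rewrite /valring_max /=.
have [->|a0] /= := eqVneq a 0; last move=> va0.
  by move=> _; rewrite invr0 /residue (_ : insubd _ _ = 0) ?rmorph0 //;
     apply/val_inj; rewrite insubdK // unfold_in /valring_pred eqxx.
rewrite /residue (_ : insubd _ _ = 0) ?rmorph0 // /insubd insubN //.
by rewrite /valring_pred invr_eq0 (negbTE a0) valV // oppr_ge0 -ltNge.
Qed.

HB.instance Definition _ :=
  GRing.ComNzRing_isField.Build residue_field residue_mulVf residue_inv0.
End ResidueField.

(* Non-strict form of a term order on the monomials x^u, u : 'X_{1..n}. *)
Definition is_term_order (n : nat) (le : rel 'X_{1..n}) : Prop :=
  [/\ total le, antisymmetric le, transitive le, forall m, le 0%MM m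
    & forall m m1 m2, le m1 m2 -> le (m1 + m)%MM (m2 + m)%MM].

(* The largest monomial of p for the order le (0%MM if p = 0). *)
Definition lead_mon (A : nzRingType) (n : nat) (le : rel 'X_{1..n})
    (p : {mpoly A[n]}) : 'X_{1..n} :=
  last 0%MM (sort le (msupp p)).

Section InitialForms.
Variables (K : fieldType) (R : realType) (v : valuation K R) (t : R -> K).
Variables (n : nat) (w : 'rV[R]_n) (le : rel 'X_{1..n}).
Implicit Types (f : {mpoly K[n]}) (u : 'X_{1..n}).

Definition wdot u : R := \sum_(i < n) w 0 i * (u i)%:R.

Definition term_weight f u : R := v f@_u + wdot u.

(* W; the head of msupp f only serves as initial value of the iterated min, so
   this is the minimum over msupp f when f != 0. *)
Definition min_weight f : R :=
  \big[Num.min/term_weight f (head 0%MM (msupp f))]_(u <- msupp f)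
    term_weight f u.

Definition in_w f : {mpoly (residue_field v)[n]} :=
  \sum_(u <- msupp f | term_weight f u == min_weight f)
    residue v (t (- v f@_u) * f@_u) *: 'X_[u].

(* Exponent vector of the monomial of the leading term in_<(in_w f). *)
Definition lm f : 'X_{1..n} := lead_mon le (in_w f).

Definition lc f : K := f@_(lm f).
End InitialForms.

(* E(f, g), the number of monomials of g that do not occur in f. *)
Definition missing_monomials (K : fieldType) (n : nat) (f g : {mpoly K[n]}) :
    nat :=
  count (fun u => f@_u == 0) (msupp g).

(* q_j, (h_1j, ..., h_sj) and r_j. *)
Record iterate (K : fieldType) (n s : nat) := Iterate {
  iq : {mpoly K[n]};
  ih : 'I_s -> {mpoly K[n]};
  ir : {mpoly K[n]}
}.

(* At counter value j, cur is the j-th iterate, past lists the iterates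
   0, ..., j - 1 in this order, and pool is T. *)
Record state (K : fieldType) (n s : nat) := State {
  cur : iterate K n s;
  past : seq (iterate K n s);
  pool : seq {mpoly K[n]}
}.

Section NormalForm.
Variables (K : fieldType) (R : realType) (v : valuation K R) (t : R -> K).
Variables (n : nat) (w : 'rV[R]_n) (le : rel 'X_{1..n}).
Variables (E : {mpoly K[n]} -> {mpoly K[n]} -> nat).
Variables (s : nat) (gs : 'I_s -> {mpoly K[n]}).
Implicit Types (st : state K n s) (g q : {mpoly K[n]}) (u : 'X_{1..n}).

Local Notation lm := (lm v t w le).
Local Notation lc := (lc v t w le).

Definition init_state (f : {mpoly K[n]}) : state K n s :=
  State (Iterate f (fun=> 0) 0) [::] [seq gs i | i <- enum 'I_s].

Definition next_state st (it : iterate K n s) (T : seq {mpoly K[n]}) :=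
  State it (rcons (past st) (cur st)) T.

(* g is in T and lm(g) divides lm(q_j). *)
Definition reducer st g : bool :=
  (g \in pool st) && (lm g <= lm (iq (cur st)))%MM.

(* g may be chosen to reduce q_j, and x^u is such that lm(x^u g) = lm(q_j). *)
Definition selects st g u : Prop :=
  [/\ reducer st g,
      forall g', reducer st g' -> (E (iq (cur st)) g <= E (iq (cur st)) g')%N
    & lm ('X_[u] * g) = lm (iq (cur st))].

Definition quotient_coef st g u : K :=
  lc (iq (cur st)) / lc ('X_[u] * g).

Definition reduct st g u : {mpoly K[n]} :=
  iq (cur st) - quotient_coef st g u *: ('X_[u] * g).

Definition pool_after st g : seq {mpoly K[n]} :=
  if (0 < E (iq (cur st)) g)%N then rcons (pool st) (iq (cur st))
  else pool st.

(* One pass through the body of the while loop; a relation, since g (and m) may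
   not be determined. *)
Inductive step st : state K n s -> Prop :=
| StepRemainder q h r :
    cur st = Iterate q h r ->
    (forall g, ~~ reducer st g) ->
    step st (next_state st
      (Iterate (q - lc q *: 'X_[lm q]) h (r + lc q *: 'X_[lm q]))
      (rcons (pool st) q))
| StepGenerator q h r g u m :
    cur st = Iterate q h r ->
    selects st g u -> g = gs m ->
    let c := quotient_coef st g u in
    step st (next_state st
      (Iterate (reduct st g u)
               (fun i => if i == m then h i + c *: 'X_[u] else h i)
               r)
      (pool_after st g))
| StepPrevious q h r g u m itm :
    cur st = Iterate q h r ->
    selects st g u -> (forall i, g <> gs i) ->
    onth (past st) m = Some itm -> g = iq itm ->
    let c := quotient_coef st g u in
    step st (next_state st
      (Iterate ((1 - c)^-1 *: reduct st g u)
               (fun i => (1 - c)^-1 *: (h i - c *: ih itm i))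
               ((1 - c)^-1 *: (r - c *: ir itm)))
      (pool_after st g)).

(* No choice of g among the previous iterates leads to 1 - c = 0: without this
   condition the convention 0^-1 = 0 would end the run. *)
Definition division_safe st : Prop :=
  forall g u, selects st g u -> (forall i, g <> gs i) ->
    1 - quotient_coef st g u != 0.

(* Every execution from st, whatever choices are made, reaches q_j = 0 after
   finitely many passes: it does not run forever, block, or divide by 0. *)
Inductive terminates st : Prop :=
| TerminatesNow :
    iq (cur st) = 0 -> terminates st
| TerminatesLater :
    iq (cur st) <> 0 -> division_safe st ->
    (exists st', step st st') ->
    (forall st', step st st' -> terminates st') ->
    terminates st.
End NormalForm.

(* Main.v *)
(* Every pass strictly lowers the leading term of q_j for the order that compares
   first val(c) + w.u and then x^u.  If q_j is reduced by an earlier q_m, then, by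
   degree, lm(q_j) = lm(q_m), so val(c_v) > 0, hence 1 - c_v is nonzero and
   dividing by it does not change weights.
   All q_j have the degree of f, so there are finitely many pairs (support of q_j,
   lm(q_j)).  When q_j is added to T, no element of T reduces it with E = 0, so
   its pair is new: T grows finitely often.  In the remaining passes
   E(q_j, g) = 0, hence the support of g is contained in that of q_j, g has the
   degree of f, x^v = 1, and the support of q_{j+1} is strictly smaller than that
   of q_j. *)
Require Import Defs.
From HB Require Import structures.
From mathcomp Require Import all_boot all_order all_algebra.
From mathcomp Require Import reals.
From mathcomp Require Import mpoly.
Local Open Scope ring_scope.
Set Implicit Arguments.
Unset Strict Implicit.
Unset Printing Implicit Defensive.
Import Order.TTheory GRing.Theory Num.Theory.

Lemma le_last_sorted (T : eqType) (r : rel T) (x0 x : T) (s : seq T) :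
  transitive r -> reflexive r -> sorted r s -> x \in s -> r x (last x0 s).
Proof.
move=> r_tr r_refl r_s xs; rewrite -nth_last -{1}(nth_index x0 xs).
move: (xs); rewrite -index_mem => ltx.
apply: (sorted_leq_nth r_tr r_refl x0 r_s) => //; rewrite ?inE.
  by rewrite prednK // (leq_trans _ ltx).
by rewrite -ltnS prednK // (leq_trans _ ltx).
Qed.

Section NormalFormTermination.
Variables (R : realType) (K : fieldType) (v : valuation K R) (t : R -> K).
Variables (n : nat) (w : 'rV[R]_n) (le : rel 'X_{1..n}).
Hypotheses (ht : is_splitting v t) (hle : is_term_order le).
Implicit Types (f g p q : {mpoly K[n]}) (u m : 'X_{1..n}).

Local Notation lm := (lm v t w le).
Local Notation lc := (lc v t w le).
Local Notation term_weight := (term_weight v w).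

(** * The order on weighted terms *)

Let le_total : total le. Proof. by case: hle. Qed.
Let le_anti : antisymmetric le. Proof. by case: hle. Qed.
Let le_trans : transitive le. Proof. by case: hle. Qed.
Let le_refl : reflexive le.
Proof. by move=> u; case/orP: (le_total u u). Qed.

(* Terms c x^u are compared through (val(c) + w.u, u); the larger weight is the
   smaller term, so that lm(f) carries the largest term of f. *)
Definition term_le (x y : R * 'X_{1..n}) : bool :=
  (y.1 < x.1) || (x.1 == y.1) && le x.2 y.2.

Definition term f u : R * 'X_{1..n} := (term_weight f u, u).
Definition lead_term f := term f (lm f).

Definition dominated (x : R * 'X_{1..n}) f : Prop :=
  {in msupp f, forall u, term_le (term f u) x}.
(** Since [term_le] is a total order, the negation says strictly smaller than [x]. *)
Definition below (x : R * 'X_{1..n}) f : Prop :=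
  {in msupp f, forall u, ~~ term_le x (term f u)}.

Lemma term_le_trans : transitive term_le.
Proof.
move=> [b y] [a x] [c z]; rewrite /term_le /=.
case/orP=> [ba|/andP[/eqP-> xy]]; case/orP=> [cb|/andP[/eqP<- yz]].
- by rewrite (lt_trans cb ba).
- by rewrite ba.
- by rewrite cb.
- by rewrite eqxx (le_trans xy yz) orbT.
Qed.

Lemma term_le_total : total term_le.
Proof.
by move=> [a x] [b y]; rewrite /term_le /= orbACA; case: ltgtP => //= _.
Qed.

Lemma term_le_anti : antisymmetric term_le.
Proof.
move=> [a x] [b y]; rewrite /term_le /=.
by case: ltgtP => //= -> xy; congr (_, _); apply: le_anti.
Qed.

Lemma term_leW a b u x : a <= b -> term_le (a, u) x -> term_le (b, u) x.
Proof.
rewrite le_eqVlt => /predU1P[->//|ab]; rewrite /term_le /=.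
by case/orP=> [xa|/andP[/eqP<- _]]; rewrite ?ab // (lt_trans xa ab).
Qed.

(** * Leading monomials through initial forms *)

Lemma lead_monP (A : nzRingType) (p : {mpoly A[n]}) : p != 0 ->
  lead_mon le p \in msupp p /\ {in msupp p, forall u, le u (lead_mon le p)}.
Proof.
move=> p0; rewrite /lead_mon; split=> [|u up].
  rewrite -(mem_sort le); move: p0; rewrite -msupp_eq0 -size_eq0.
  by rewrite -(size_sort le); case: (sort _ _) => //= x s _; apply: mem_last.
apply: le_last_sorted; [exact: le_trans|exact: le_refl| |].
  exact: sort_sorted.
by rewrite mem_sort.
Qed.

Lemma min_weight_le f u : u \in msupp f -> min_weight v w f <= term_weight f u.
Proof. by move=> uf; apply: ge_bigmin_seq. Qed.

Lemma min_weight_attained f : f != 0 ->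
  exists2 u, u \in msupp f & term_weight f u = min_weight v w f.
Proof.
move=> f0; rewrite /min_weight big_seq.
apply: (big_ind (fun a => exists2 u, u \in msupp f & term_weight f u = a)).
- exists (head 0%MM (msupp f)) => //.
  by move: f0; rewrite -msupp_eq0; case: (msupp f) => //= x s _; apply: mem_head.
- by move=> a b ha hb; rewrite minEle; case: ifP.
- by move=> u uf; exists u.
Qed.

Lemma residue_neq0 a : a != 0 -> v a = 0 -> residue v a != 0.
Proof.
move=> a0 va; rewrite /residue residue_eq0 /valring_max insubdK.
  by rewrite (negbTE a0) va ltxx.
by rewrite unfold_in /valring_pred va lexx orbT.
Qed.

(** The rescaled coefficient has valuation 0, so its residue is nonzero and no term of minimal
    weight is lost on passing to the residue field. *)
Lemma mem_msupp_in_w f u :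
  (u \in msupp (in_w v t w f)) =
  (u \in msupp f) && (term_weight f u == min_weight v w f).
Proof.
case: ht => t_neq0 _ tK.
rewrite [LHS]mcoeff_msupp /in_w raddf_sum /= big_mkcond /=.
have [uf|uf] := boolP (u \in msupp f); last first.
  rewrite big_seq big1 ?eqxx // => m mf; case: ifP => // _.
  by rewrite mcoeffZ mcoeffX; case: eqP uf => [<-|]; rewrite ?mf ?mulr0.
rewrite (bigD1_seq u) ?msupp_uniq //= big1 ?addr0 => [|m /negbTE mu]; last first.
  by case: ifP => // _; rewrite mcoeffZ mcoeffX mu mulr0.
case: ifP => _; rewrite ?eqxx // mcoeffZ mcoeffX eqxx mulr1.
move: uf; rewrite mcoeff_msupp => fu0.
have gu : value_group v (- v f@_u) by exists (f@_u)^-1; rewrite ?invr_eq0 ?valV.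
by apply: residue_neq0; rewrite ?mulf_neq0 ?t_neq0 // Defs.valM ?t_neq0 // tK ?addNr.
Qed.

(** [in_w] keeps the terms of minimal weight and [le] decides among them: together this is the
    lexicographic comparison [term_le]. *)
Lemma lmP f : f != 0 -> lm f \in msupp f /\ dominated (lead_term f) f.
Proof.
move=> f0; have in0 : in_w v t w f != 0.
  have [u uf uW] := min_weight_attained f0.
  by rewrite -msupp_eq0; apply/eqP=> e; have := mem_msupp_in_w f u;
     rewrite e in_nil uf uW eqxx.
have [lmin lmax] := lead_monP in0.
move: (lmin); rewrite mem_msupp_in_w => /andP[lmf /eqP lmW]; split=> // u uf.
rewrite /lead_term /term_le /= lmW.
move: (min_weight_le uf); rewrite le_eqVlt => /predU1P[e|-> //].
by rewrite -e eqxx lmax ?orbT // mem_msupp_in_w uf e eqxx.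
Qed.

Lemma lm_eq f m : m \in msupp f -> dominated (term f m) f -> lm f = m.
Proof.
move=> mf dom; have f0 : f != 0.
  by apply: contraTneq mf => ->; rewrite msupp0.
have [lf ldom] := lmP f0.
by have [] := term_le_anti (introT andP (conj (dom _ lf) (ldom _ mf))).
Qed.

Lemma lc_neq0 f : f != 0 -> lc f != 0.
Proof. by move=> /lmP[lf _]; rewrite /lc -mcoeff_msupp. Qed.

(** * Term bounds under subtraction and scaling *)

Lemma dominatedB x p q : dominated x p -> dominated x q -> dominated x (p - q).
Proof.
move=> dp dq u; rewrite mcoeff_msupp /term /Defs.term_weight mcoeffB => pq0.
have [p0|p0] := eqVneq p@_u 0.
  by move: pq0; rewrite p0 sub0r oppr_eq0 valN -mcoeff_msupp => /dq.
have [q0|q0] := eqVneq q@_u 0.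
  by move: pq0; rewrite q0 subr0 -mcoeff_msupp => /dp.
have Nq0 : - q@_u != 0 by rewrite oppr_eq0.
(* By the ultrametric inequality the new term is at most one of the two old ones. *)
have := Defs.valD v p0 Nq0 pq0; rewrite valN ge_min.
move=> le_v; move: p0 q0; rewrite -!mcoeff_msupp => /dp tp /dq tq.
by case/orP: le_v => le_v; [apply: term_leW tp | apply: term_leW tq];
   rewrite lerD2r.
Qed.

Lemma dominated_below x p : dominated x p -> p@_(x.2) = 0 -> below x p.
Proof.
move=> dp px u up; apply: contraTN up => xu.
rewrite mcoeff_msupp negbK; have [up|up] := boolP (u \in msupp p).
  by rewrite (_ : u = x.2) ?px // (term_le_anti (introT andP (conj xu (dp _ up)))).
by rewrite mcoeff_eq0.
Qed.

Lemma below_trans x p q :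
  p != 0 -> below x p -> dominated (lead_term p) q -> below x q.
Proof.
move=> p0 bp dq u uq; have [lp _] := lmP p0.
by apply: contra (bp _ lp) => /term_le_trans; apply; apply: dq.
Qed.

Lemma term_weightZ a f u : a != 0 -> u \in msupp f ->
  term_weight (a *: f) u = v a + term_weight f u.
Proof.
by rewrite mcoeff_msupp => a0 fu; rewrite /Defs.term_weight mcoeffZ Defs.valM // addrA.
Qed.

Lemma mem_msuppZ a f u : a != 0 -> (u \in msupp (a *: f)) = (u \in msupp f).
Proof. by move=> a0; rewrite !mcoeff_msupp mcoeffZ mulf_eq0 (negbTE a0). Qed.

Lemma below_scale a x f : a != 0 -> v a = 0 -> below x f -> below x (a *: f).
Proof.
move=> a0 va bf u; rewrite mem_msuppZ // => uf.
by rewrite /term term_weightZ // va add0r bf.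
Qed.

(** * Cancellation of leading terms *)

(** [quotient_coef st g u] unfolds to this with [p] the product of ['X_[u]] and [g]. *)
Definition lead_quotient q p := lc q / lc p.

Lemma val_lead_quotient q p : q != 0 -> p != 0 -> lm q = lm p ->
  v (lead_quotient q p) = (lead_term q).1 - (lead_term p).1.
Proof.
move=> q0 p0 e; have [lq lp] := (lc_neq0 q0, lc_neq0 p0).
rewrite Defs.valM ?invr_eq0 // valV //= /Defs.term_weight e.
by rewrite /lc e opprD addrACA subrr addr0.
Qed.

(** Scaling shifts all weights of [p] equally, so that its leading term takes the weight of that of
    [q]. Both polynomials are then dominated by this term, and its coefficient cancels. *)
Lemma below_cancel q p : q != 0 -> p != 0 -> lm q = lm p ->
  below (lead_term q) (q - lead_quotient q p *: p).
Proof.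
move=> q0 p0 e; have [_ dq] := lmP q0; have [_ dp] := lmP p0.
have lq0 : lead_quotient q p != 0 by rewrite mulf_neq0 ?invr_eq0 ?lc_neq0.
apply: dominated_below.
  apply: dominatedB => // u; rewrite mem_msuppZ // => up.
  have := dp _ up; rewrite /term_le /= term_weightZ // val_lead_quotient //=.
  rewrite e -addrA (addrC (- _)) ltrDl subr_gt0.
  have eqD (a b : R) : (a + b == a) = (b == 0) by rewrite addrC -subr_eq0 addrK.
  by rewrite eqD subr_eq0.
by rewrite mcoeffB mcoeffZ /lead_quotient /lc -e divfK ?subrr // e; apply: lc_neq0.
Qed.

(** Multiplication by ['X_[u]] adds the constant [wdot w u] to all weights, and [le] is compatible
    with addition of exponents. *)
Lemma lm_mulX u g : g != 0 -> lm ('X_[u] * g) = (u + lm g)%MM.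
Proof.
move=> g0; have [lg dg] := lmP g0.
have tw m : term_weight ('X_[u] * g) (u + m) = wdot w u + term_weight g m.
  rewrite /Defs.term_weight mulrC mcoeffMX /wdot addrCA; congr (_ + _).
  by rewrite -big_split; apply: eq_bigr => i _; rewrite mnmDE natrD mulrDr.
apply: lm_eq => [|m]; rewrite mulrC (perm_mem (msuppMX _ _)).
  by apply: map_f.
case/mapP=> k kg ->; have := dg _ kg.
rewrite /term_le /= mulrC !tw.
rewrite ltrD2l (inj_eq (addrI _)); case/orP=> [->//|/andP[-> lk]].
case: hle => _ _ _ _ leD.
by rewrite ![(u + _)%MM]addmC leD ?orbT.
Qed.

Lemma lm_X u : lm 'X_[u] = u.
Proof.
by apply: lm_eq => [|m]; rewrite msuppX mem_seq1 // => /eqP->; apply/orP; right;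
   rewrite eqxx /=.
Qed.

(** With equal leading monomials, being strictly below can only come from a strictly larger
    weight. *)
Lemma val_lead_quotient_gt0 q p : q != 0 -> p != 0 -> lm q = lm p ->
  below (lead_term p) q -> 0 < v (lead_quotient q p).
Proof.
move=> q0 p0 e bq; have [lq _] := lmP q0; have := bq _ lq.
rewrite val_lead_quotient // subr_gt0 /term_le /= negb_or.
by rewrite e le_refl andbT -leNgt lt_def eq_sym => /andP[-> ->].
Qed.

Lemma val_1B a : a != 0 -> 0 < v a -> 1 - a != 0 /\ v (1 - a) = 0.
Proof.
move=> a0 va; have a1 : 1 - a != 0.
  by rewrite subr_eq0; apply: contraTneq va => <-; rewrite Defs.val1 ltxx.
split=> //; apply/eqP; rewrite eq_le.
have Na0 : - a != 0 by rewrite oppr_eq0.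
have := Defs.valD v (oner_neq0 K) Na0 a1; rewrite Defs.val1 valN (min_l (ltW va)) => ->.
(* Writing 1 as [(1 - a) + a] bounds the valuation of [1 - a] from above, as [v a] is positive. *)
rewrite andbT; have := Defs.valD v a1 a0; rewrite subrK Defs.val1 => /(_ (oner_neq0 K)).
by rewrite ge_min => /orP[//|/(lt_le_trans va)]; rewrite ltxx.
Qed.

Lemma size_msupp_cancel q p : q != 0 -> p != 0 -> lm q = lm p ->
  {subset msupp p <= msupp q} ->
  (size (msupp (q - lead_quotient q p *: p)) < size (msupp q))%N.
Proof.
move=> q0 p0 e pq; have [lq _] := lmP q0.
(* [lm q] has cancelled and no new monomial appears, so prepending it to the new support gives a
   duplicate-free list inside the old one. *)
apply: (@uniq_leq_size _ (lm q :: msupp _)) => [|u] /=.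
  rewrite msupp_uniq andbT mcoeff_msupp negbK mcoeffB mcoeffZ.
  by rewrite /lead_quotient /lc -e divfK ?subrr ?eqxx // e; apply: lc_neq0.
rewrite inE => /predU1P[->//|].
apply: contraTT => uq; have up : u \notin msupp p by apply: contra uq; apply: pq.
move: uq up; rewrite !mcoeff_msupp !negbK mcoeffB mcoeffZ => /eqP-> /eqP->.
by rewrite mulr0 subrr.
Qed.

(** * The invariant and the termination measure *)

Variables (s : nat) (gs : 'I_s -> {mpoly K[n]}) (d : nat).
Hypothesis gs_neq0 : forall i, gs i != 0.
Hypothesis gs_homog : forall i, exists e : nat, gs i \is e.-homog.
Implicit Types (st : state K n s).

Local Notation E := (@missing_monomials K n).
Local Notation reducer := (reducer v t w le).
Local Notation selects := (selects v t w le E).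
Local Notation step := (step v t w le E gs).

Lemma missing_monomials_eq0 f g :
  (E f g == 0)%N = all (mem (msupp f)) (msupp g).
Proof.
rewrite /missing_monomials -leqn0 leqNgt -has_count -all_predC.
by apply: eq_all => u /=; rewrite mcoeff_msupp.
Qed.

(** Generators in T may have any degree, whereas earlier iterates have degree [d]. The strict
    descent below every earlier iterate is what makes division by [1 - c] safe. *)
Record state_inv st : Prop := StateInv {
  cur_homog : iq (cur st) \is d.-homog;
  past_inv : forall g, g \in [seq iq it | it <- past st] ->
    [/\ g != 0, g \is d.-homog & below (lead_term g) (iq (cur st))];
  pool_inv : forall g, g \in pool st ->
    (exists i, g = gs i) \/ g \in [seq iq it | it <- past st]
}.

(* The monomials of degree d contain those of every iterate; a pair (A, m) is
   covered by T when some g in T would reduce, with E = 0, any polynomial with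
   support A and leading monomial m. *)
Definition covered (T : seq {mpoly K[n]})
    (x : {set 'X_{1..n < d.+1}} * 'X_{1..n < d.+1}) : bool :=
  has (fun g => all (mem [seq bmnm b | b in x.1]) (msupp g) &&
                (lm g <= x.2)%MM) T.

(** First component of a lexicographic measure; the second is the size of the support of the current
    polynomial. *)
Definition uncovered T := #|[pred x | ~~ covered T x]|.

Lemma uncovered_rcons st :
  iq (cur st) != 0 -> iq (cur st) \is d.-homog ->
  (forall g, reducer st g -> 0 < E (iq (cur st)) g)%N ->
  (uncovered (rcons (pool st) (iq (cur st))) < uncovered (pool st))%N.
Proof.
set q := iq _ => q0 /dhomogP hq noE.
have [lq _] := lmP q0.
have ltd u : u \in msupp q -> (mdeg u < d.+1)%N by move=> /hq ->.
(* The newly covered pair: [q] covers its own support and leading monomial, while an older element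
   covering them would be a reducer with E = 0. *)
pose x := ([set b : 'X_{1..n < d.+1} | bmnm b \in msupp q],
           BMultinom (ltd _ lq)).
have mem_x u : (u \in [seq bmnm b | b in x.1]) = (u \in msupp q).
  apply/imageP/idP => [[b] | uq]; first by rewrite inE => bq ->.
  by exists (BMultinom (ltd _ uq)); rewrite ?inE.
apply: proper_card; apply/properP; split.
  apply/subsetP => y; rewrite !inE /covered has_rcons negb_or.
  by case/andP.
exists x; rewrite !inE /covered ?has_rcons.
  apply/hasPn => g gT; apply/negP => /andP[/allP gx lg].
  have /noE : reducer st g by rewrite /Defs.reducer gT lg.
  rewrite lt0n missing_monomials_eq0 => /allP[] u /gx.
  by rewrite !inE mem_x.
rewrite negbK; apply/orP; left; apply/andP; split; last exact: lepm_refl.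
by apply/allP => u; rewrite inE mem_x.
Qed.

Lemma pool_neq0 st g : state_inv st -> g \in pool st -> g != 0.
Proof.
by move=> inv_st /(pool_inv inv_st)[[i ->]|/(past_inv inv_st)[]].
Qed.

Lemma pool_homog st g :
  state_inv st -> g \in pool st -> exists e, g \is e.-homog.
Proof.
by move=> inv_st /(pool_inv inv_st)[[i ->]|/(past_inv inv_st)[]] //; exists d.
Qed.

Lemma mulX_neq0 u g : g != 0 -> 'X_[u] * g != 0.
Proof. by move=> g0; rewrite mulf_neq0 // -msupp_eq0 msuppX. Qed.

Lemma selects_neq0 st g u : state_inv st -> selects st g u -> 'X_[u] * g != 0.
Proof.
by move=> inv_st [/andP[gT _] _ _]; apply/mulX_neq0/(pool_neq0 inv_st gT).
Qed.

(** * The effect of one pass *)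

Lemma reduct_homog st g u : state_inv st -> iq (cur st) != 0 ->
  selects st g u -> reduct v t w le st g u \is d.-homog.
Proof.
move=> inv_st q0 sel; have p0 := selects_neq0 inv_st sel.
have [/andP[gT _] _ elm] := sel; have [e ge] := pool_homog inv_st gT.
have hq := cur_homog inv_st.
have pe : 'X_[u] * g \is (mdeg u + e).-homog by rewrite dhomogM // dhomogX.
have [lp _] := lmP p0; have [lq _] := lmP q0.
(* The shared leading monomial forces the product to have degree [d]. *)
have := dhomogP _ _ _ pe _ lp; rewrite elm (dhomogP _ _ _ hq _ lq) => ed.
by rewrite rpredB // dhomogZ // ed.
Qed.

Lemma selects_homog_eq0 st g u : state_inv st -> iq (cur st) != 0 ->
  selects st g u -> g \is d.-homog -> u = 0%MM.
Proof.
move=> inv_st q0 [/andP[gT _] _ elm] hg; have g0 := pool_neq0 inv_st gT.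
have [lg _] := lmP g0; have [lq _] := lmP q0.
apply/eqP; rewrite -mdeg_eq0 -(eqn_add2r (mdeg (lm g))) -mdegD -lm_mulX // elm.
by rewrite (dhomogP _ _ _ hg _ lg) (dhomogP _ _ _ (cur_homog inv_st) _ lq).
Qed.

Lemma pool_after_lt st g u : state_inv st -> iq (cur st) != 0 ->
  selects st g u ->
  (uncovered (pool_after E st g) < uncovered (pool st))%N \/
  uncovered (pool_after E st g) = uncovered (pool st) /\
  (size (msupp (reduct v t w le st g u)) < size (msupp (iq (cur st))))%N.
Proof.
move=> inv_st q0 sel; have [/andP[gT lg] minE elm] := sel.
rewrite /pool_after; case: posnP => [E0|Epos]; [right; split=> //|left]; last first.
  (* By minimality of the choice of [g], a positive E for [g] is positive for every reducer. *)
  apply: uncovered_rcons => // [|g' /minE]; first exact: cur_homog.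
  exact: leq_trans.
move/eqP: E0; rewrite missing_monomials_eq0 => /allP gq.
have hg : g \is d.-homog.
  by apply/dhomogP => m /gq mq; apply: (dhomogP _ _ _ (cur_homog inv_st)).
apply: size_msupp_cancel => //; first exact: (selects_neq0 inv_st sel).
by rewrite (selects_homog_eq0 inv_st q0 sel hg) mpolyX0 mul1r.
Qed.

(** An earlier iterate has degree [d], so [u] is zero and the leading monomials agree; the descent
    recorded in the invariant then gives [c] positive valuation. *)
Lemma quotient_coef_previous st g u : state_inv st -> iq (cur st) != 0 ->
  selects st g u -> g \in [seq iq it | it <- past st] ->
  let c := quotient_coef v t w le st g u in 1 - c != 0 /\ v (1 - c) = 0.
Proof.
move=> inv_st q0 sel gp; have p0 := selects_neq0 inv_st sel.
have [g0 hg bg] := past_inv inv_st gp; have [_ _ elm] := sel.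
apply: val_1B; first by rewrite mulf_neq0 ?invr_eq0 ?lc_neq0.
apply: val_lead_quotient_gt0 => //.
by rewrite (selects_homog_eq0 inv_st q0 sel hg) mpolyX0 mul1r.
Qed.

Lemma next_state_inv st (it : iterate K n s) T :
  state_inv st -> iq (cur st) != 0 ->
  iq it \is d.-homog -> below (lead_term (iq (cur st))) (iq it) ->
  {subset T <= rcons (pool st) (iq (cur st))} ->
  state_inv (next_state st it T).
Proof.
move=> inv_st q0 hit bit sT; have hq := cur_homog inv_st.
(* The weak bound lets [below_trans] carry the descent on to all older iterates. *)
have dq : dominated (lead_term (iq (cur st))) (iq it).
  move=> u /bit /negbTE le_false.
  by case/orP: (term_le_total (term (iq it) u) (lead_term (iq (cur st))));
     rewrite ?le_false.
split=> //= g; rewrite map_rcons mem_rcons inE.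
  case/predU1P=> [->//|gp]; have [g0 hg bg] := past_inv inv_st gp.
  by split=> //; apply: below_trans bg dq.
move/sT; rewrite mem_rcons inE => /predU1P[->|]; first by right; rewrite eqxx.
by case/(pool_inv inv_st)=> [|->]; [left | right; rewrite orbT].
Qed.

Lemma sub_pool_after st g :
  {subset pool_after E st g <= rcons (pool st) (iq (cur st))}.
Proof.
rewrite /pool_after => g'; case: ifP => // _.
by rewrite mem_rcons inE orbC => ->.
Qed.

Lemma step_inv st st' : state_inv st -> iq (cur st) != 0 -> step st st' ->
  state_inv st' /\
  ((uncovered (pool st') < uncovered (pool st))%N \/
   uncovered (pool st') = uncovered (pool st) /\
   (size (msupp (iq (cur st'))) < size (msupp (iq (cur st))))%N).
Proof.
move=> inv_st q0 stp; have hq := cur_homog inv_st.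
case: stp => [q h r eq_cur nored|q h r g u m _ sel _ c|
              q h r g u m itm _ sel _ gm eg c].
- have eq_q : iq (cur st) = q by rewrite eq_cur.
  move: q0 hq; rewrite -eq_q in nored * => q0 hq; set q' := _ - _ *: _.
  (* Moving a term to the remainder is a cancellation against the monomial itself, whose leading
     coefficient is 1. *)
  have eq_q' : q' = iq (cur st) -
    lead_quotient (iq (cur st)) 'X_[lm (iq (cur st))] *: 'X_[lm (iq (cur st))].
    by rewrite /q' /lead_quotient /Defs.lc lm_X mcoeffX eqxx divr1.
  have X0 : 'X_[lm (iq (cur st))] != 0 :> {mpoly K[n]} by rewrite -msupp_eq0 msuppX.
  split; last first.
    by left; apply: uncovered_rcons => // g; rewrite (negbTE (nored g)).
  apply: next_state_inv => //=.
    rewrite rpredB // dhomogZ // dhomogX; have [lq _] := lmP q0.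
    by rewrite (dhomogP _ _ _ hq _ lq).
  by rewrite -/q' eq_q'; apply: below_cancel; rewrite ?lm_X.
- have p0 := selects_neq0 inv_st sel; have [_ _ elm] := sel.
  split; last exact: pool_after_lt.
  apply: next_state_inv => //=; first exact: reduct_homog.
    exact: below_cancel.
  exact: sub_pool_after.
- have gp : g \in [seq iq it | it <- past st].
    by apply/onthP; exists m; rewrite onth_map gm eg.
  have p0 := selects_neq0 inv_st sel; have [_ _ elm] := sel.
  have [c0 vc] := quotient_coef_previous inv_st q0 sel gp.
  have ci0 : (1 - c)^-1 != 0 by rewrite invr_eq0.
  split; last first.
    have [lt|[-> lt]] := pool_after_lt inv_st q0 sel; [by left | right; split=> //=].
    (* Division by the nonzero [1 - c] leaves the support unchanged. *)
    rewrite (_ : size _ = size (msupp (reduct v t w le st g u))) //.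
    apply: perm_size; apply: uniq_perm; rewrite ?msupp_uniq // => m'.
    exact: mem_msuppZ.
  apply: next_state_inv => //=.
  + by rewrite dhomogZ // reduct_homog.
  + apply: below_scale => //; first by rewrite valV // vc oppr0.
    exact: below_cancel.
  + exact: sub_pool_after.
Qed.

(** * Progress and termination *)

Lemma step_exists st : state_inv st -> iq (cur st) != 0 ->
  exists st', step st st'.
Proof.
move=> inv_st q0; case eq_cur: (cur st) => [q h r].
have [/hasP[g0 g0T g0r]|/hasPn nored] := boolP (has (reducer st) (pool st)); last first.
  have nr g : ~~ reducer st g.
    by apply/negP => gr; have /andP[gT _] := gr; have := nored _ gT; rewrite gr.
  by eexists; apply: StepRemainder eq_cur nr.
have ex_red : exists k, has (fun g => reducer st g && (E (iq (cur st)) g == k)) (pool st).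
  by exists (E (iq (cur st)) g0); apply/hasP; exists g0; rewrite // g0r /=.
case: (ex_minnP ex_red) => k /hasP[g gT /andP[gr /eqP Eg]] min_k.
have sel : selects st g (lm (iq (cur st)) - lm g)%MM.
  split=> // [g' g'r|].
    have /andP[g'T _] := g'r; rewrite Eg; apply: min_k.
    by apply/hasP; exists g'; rewrite // g'r /=.
  have /andP[_ lg] := gr; rewrite lm_mulX ?submK //.
  exact: (pool_neq0 inv_st gT).
(* Generators are tested first, since [StepPrevious] requires [g] to differ from all of them. *)
have [/existsP[i /eqP gi]|/existsPn ngs] := boolP [exists i, g == gs i].
  by eexists; apply: (StepGenerator eq_cur sel gi).
have [[i gi]|/onthP[m]] := pool_inv inv_st gT.
  by have := ngs i; rewrite gi eqxx.
rewrite onth_map; case gm: (onth _ m) => [itm|] //= [eg].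
by eexists; apply: (StepPrevious eq_cur sel _ gm (esym eg)) => i gi;
   have := ngs i; rewrite gi eqxx.
Qed.

Lemma state_inv_terminates st :
  state_inv st -> terminates v t w le E gs st.
Proof.
have [N] := ubnP (uncovered (pool st)).
have [M] := ubnP (size (msupp (iq (cur st)))).
(* Lexicographic induction: [M] is generalized in the outer one because the support may grow when T
   does. *)
elim: N M st => // N IHN; elim=> // M IHM st ltM ltN inv_st.
have [/eqP q0|q0] := boolP (iq (cur st) == 0); first exact: TerminatesNow.
apply: TerminatesLater; first exact/eqP.
- move=> g u sel ngs.
  have [/andP[gT _] _ _] := sel.
  have [[i gi]|gp] := pool_inv inv_st gT; first by case: (ngs i).
  by have [] := quotient_coef_previous inv_st q0 sel gp.
- exact: step_exists.
- move=> st' /(step_inv inv_st q0)[inv' [lt|[e lt]]].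
    by apply: IHN (leq_trans lt _) inv' => //; apply: leqnn.
  by apply: IHM inv'; rewrite ?e //; apply: leq_trans lt _.
Qed.
End NormalFormTermination.

Theorem lemma2p6 (R : realType) (K : fieldType) (v : valuation K R)
    (t : R -> K) (ht : is_splitting v t)
    (n s : nat) (gs : 'I_s -> {mpoly K[n]})
    (gs_neq0 : forall i, gs i != 0)
    (gs_homog : forall i, exists d : nat, gs i \is d.-homog)
    (f : {mpoly K[n]}) (f_homog : exists d : nat, f \is d.-homog)
    (w : 'rV[R]_n) (le : rel 'X_{1..n}) (hle : is_term_order le) :
  terminates v t w le (@missing_monomials K n) gs (init_state gs f).
Proof.
case: f_homog => d hf; apply: (@state_inv_terminates _ _ _ _ _ _ _ ht hle _ _ d) => //.
by split=> //= g /mapP[i _ ->]; left; exists i.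
Qed.
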